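(* Let $S$ be a countable scattered chain such that $r_H(S) < \omega$ and assume additionally that $S$ has bounded finite sums. Then $S$ has finite big Ramsey spectrum, that is, $T(n, S) < \infty$ for every integer $n \ge 1$.
   Context: A chain is a strictly linearly ordered set; the empty chain is allowed. $\mathbb{N} = \{1,2,3,\dots\}$. For chains, $A \hookrightarrow B$ means $A$ order-embeds into $B$, and $A \equiv B$ means $A \hookrightarrow B$ and $B \hookrightarrow A$. For a chain $A$ and chains $B_a$ ($a\in A$), $\sum_{a \in A} B_a$ is the set $\bigcup_{a \in A} (\{a\} \times B_a)$ ordered lexicographically; $B_0+\dots+B_n$ is the finite sum. $\omega^*$ is $\omega$ with reversed order. A chain is scattered if $\mathbb{Q}$ does not embed into it. Hausdorff rank: let $\mathcal{H}_0$ consist of the empty chain and the one-element chain, and for an ordinal $\alpha > 0$ let $\mathcal{H}_\alpha = \{\sum_{i \in \mathbb{Z}} S_i : S_i \in \bigcup_{\beta<\alpha} \mathcal{H}_\beta \text{ for all } i\}$ (up to isomorphism). For a countable scattered chain $S$, $r_H(S)$ is the least $\alpha$ with $S \in \mathcal{H}_\alpha$. Big Ramsey degree: $n \in \mathbb{N}$ is identified with the chain $0<1<\dots<n-1$; $\mathrm{Emb}(n, C)$ is the set of order embeddings $n \hookrightarrow C$. $T(n, C)$ is the least integer $t \ge 1$ such that for every $k \ge 2$ and every $\chi : \mathrm{Emb}(n, C) \to \{0,\dots,k-1\}$ there is a $U \subseteq C$ order-isomorphic to $C$ with $|\chi(\mathrm{Emb}(n, U))| \le t$; if no such $t$ exists,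 $T(n, C) = \infty$. Trees: consider rooted trees in which the edges going out of each vertex are linearly ordered, vertices carry labels from $\{0, 1, +, \omega, \omega^*\}$ and edges carry labels from $\omega \cup \{\iota_n : n \in \omega\}$, where the $\iota_n$ are distinct symbols not in $\omega$. Each tree $\tau$ below encodes a chain $\|\tau\|$. - $\bullet 0$ and $\bullet 1$ are the single-vertex trees with vertex labelled $0$, resp. $1$; $\|\bullet 0\| = \varnothing$ and $\|\bullet 1\| = 1$ (the one-element chain). - For $n \in \mathbb{N}$, $\tau_0 + \dots + \tau_n$ is the tree whose root is labelled $+$, with outgoing edges labelled $\iota_0, \dots, \iota_n$, ordered in that way, the edge $\iota_k$ leading to a copy of $\tau_k$; it encodes $\|\tau_0\| + \dots + \|\tau_n\|$. - $\sum_{k \in \omega} \tau_k$ (resp. $\sum_{k \in \omega^*} \tau_k$) is the tree whose root is labelled $\omega$ (resp. $\omega^*$), with outgoing edges labelled by and ordered as $\omega$ (resp. $\omega^*$), the edge $k$ leading to a copy of $\tau_k$; it encodes $\sum_{k \in \omega} \|\tau_k\|$ (resp. $\sum_{k \in \omega^*} \|\tau_k\|$). Let $\mathcal{A}_0 = \{\bullet 0, \bullet 1\}$. For $m \ge 1$ let $\mathcal{A}_m$ consist of: all trees $\sum_{k \in \omega} \tau_k$ and all trees $\sum_{k \in \omega^*} \tau_k$ with $\tau_k \in \bigcup_{i<m} \mathcal{A}_i$ and $\|\tau_0\| \hookrightarrow \|\tau_1\| \hookrightarrow \cdots$; and all trees $\sum_{k \in \omega} (\tau_{k0} + \dots + \tau_{kn})$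 and all trees $\sum_{k \in \omega^*} (\tau_{k0} + \dots + \tau_{kn})$ with $n \in \mathbb{N}$, $\tau_{kj} \in \bigcup_{i<m} \mathcal{A}_i$ and $\|\tau_{0j}\| \hookrightarrow \|\tau_{1j}\| \hookrightarrow \cdots$ for all $0 \le j \le n$. Let $\mathcal{A} = \bigcup_{m \in \omega} \mathcal{A}_m$ and $\mathcal{S} = \mathcal{A} \cup \{\tau_0 + \dots + \tau_n : n \in \mathbb{N},\ \tau_0, \dots, \tau_n \in \mathcal{A}\}$. A tree $\sigma \in \mathcal{S}$ has bounded finite sums if there is a $w \in \mathbb{N}$ such that every edge label occurring in $\sigma$ belongs to $\omega \cup \{\iota_0, \dots, \iota_w\}$. A countable scattered chain $S$ of finite Hausdorff rank has bounded finite sums if there is a tree $\sigma \in \mathcal{S}$ with bounded finite sums such that $S \equiv \|\sigma\|$. *)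

(* Defs.v *)
From HB Require Import structures.
From mathcomp Require Import all_boot all_order ssrint rat.
From mathcomp Require Import boolp classical_sets functions cardinality.

Set Implicit Arguments.
Unset Strict Implicit.
Unset Printing Implicit Defensive.

Import Order.TTheory.
Local Open Scope classical_set_scope.
Local Open Scope order_scope.

(* A chain is an [orderType], whose display [d] carries no mathematical       *)
(* content. The empty chain is allowed. The chain n is ['I_n], omega^* is     *)
(* [nat^d], and the sum of the chains B a for a : A is the library's          *)
(* lexicographic order on [{a : A & B a}].                                    *)

Definition order_embedding dA dB (A : orderType dA) (B : orderType dB)
    (f : A -> B) : Prop :=
  {mono f : x y / x < y}.

Definition embeds dA dB (A : orderType dA) (B : orderType dB) : Prop :=
  exists f : A -> B, order_embedding f.

Definition equimorphic dA dB (A : orderType dA) (B : orderType dB) : Prop :=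
  embeds A B /\ embeds B A.

Definition isomorphic dA dB (A : orderType dA) (B : orderType dB) : Prop :=
  exists f : A -> B, bijective f /\ order_embedding f.

Definition isomorphic_subset d (C : orderType d) (U : set C) : Prop :=
  exists g : C -> C, set_bij [set: C] U g /\ order_embedding g.

Definition scattered d (S : orderType d) : Prop := ~ embeds rat S.

(* The ordinal indexing the class is an element [a] of a well-order [W], and  *)
(* stands for the order type of its initial segment [{b | b < a}]; the class  *)
(* depends on nothing else. In [hausdorff_sum] the hypothesis a > 0 is        *)
(* implied, as the index set of the sum is nonempty.                          *)
Inductive hausdorff dW (W : orderType dW) d : W -> orderType d -> Prop :=
| hausdorff_zero (a : W) (S : orderType d) :
    (forall b : W, a <= b) ->
    isomorphic S 'I_0 \/ isomorphic S 'I_1 ->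
    hausdorff a S
| hausdorff_sum (a : W) (S : orderType d) (X : int -> orderType d) :
    (forall i, exists2 b : W, b < a & hausdorff b (X i)) ->
    isomorphic S {i : int & X i} ->
    hausdorff a S.

Definition is_hausdorff_rank dW (W : orderType dW) d (S : orderType d)
    (a : W) : Prop :=
  hausdorff a S /\ forall b : W, hausdorff b S -> a <= b.

(* The ordinals below omega are the elements of the well-order [nat]. *)
Definition finite_hausdorff_rank d (S : orderType d) : Prop :=
  exists r : nat, is_hausdorff_rank S r.

Definition Emb (n : nat) d (C : orderType d) : Type :=
  {f : 'I_n -> C | order_embedding f}.

Definition Emb_in (n : nat) d (C : orderType d) (U : set C) : set (Emb n C) :=
  [set f | range (sval f) `<=` U].

Definition ramsey_bound (n : nat) d (C : orderType d) (t : nat) : Prop :=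
  (1 <= t)%N /\
  forall k : nat, (2 <= k)%N -> forall chi : Emb n C -> 'I_k,
  exists U : set C,
    isomorphic_subset U /\ (chi @` Emb_in U #<= `I_t)%card.

(* [None] stands for infinity. *)
Definition big_ramsey_degree (n : nat) d (C : orderType d) : option nat :=
  match pselect (exists t : nat, `[< ramsey_bound n C t >]) with
  | left t_ex => Some (ex_minn t_ex)
  | right _ => None
  end.

Definition finite_big_ramsey_spectrum d (C : orderType d) : Prop :=
  forall n : nat, (1 <= n)%N -> big_ramsey_degree n C <> None.

(* The constructors are the possible labels 0, 1, +, omega, omega^* of the    *)
(* root, and their function argument gives the subtrees hanging from the root *)
(* in the order of their indices (the reversed order for [tree_omegastar]).   *)
(* [@tree_plus n tau] is tau_0 + ... + tau_n; the requirement n >= 1 is       *)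
(* imposed in [in_A] and [in_S].                                              *)
Inductive tree : Type :=
| tree0
| tree1
| tree_plus (n : nat) of ('I_n.+1 -> tree)
| tree_omega of (nat -> tree)
| tree_omegastar of (nat -> tree).

Inductive edge_label : Type :=
| label_nat of nat
| label_iota of nat.

Fixpoint edge_label_occurs (sigma : tree) (l : edge_label) : Prop :=
  match sigma with
  | tree0 | tree1 => False
  | tree_plus n tau =>
      exists k : 'I_n.+1, l = label_iota k \/ edge_label_occurs (tau k) l
  | tree_omega tau | tree_omegastar tau =>
      exists k : nat, l = label_nat k \/ edge_label_occurs (tau k) l
  end.

Fixpoint encoded (sigma : tree) : orderType Order.OrdinalOrder.ord_display :=
  match sigma with
  | tree0 => 'I_0
  | tree1 => 'I_1
  | tree_plus n tau => {k : 'I_n.+1 & encoded (tau k)}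
  | tree_omega tau => {k : nat & encoded (tau k)}
  | tree_omegastar tau => {k : nat^d & encoded (tau k)}
  end.

Definition increasing (tau : nat -> tree) : Prop :=
  forall k, embeds (encoded (tau k)) (encoded (tau k.+1)).

Inductive in_A_level : nat -> tree -> Prop :=
| in_A_tree0 : in_A_level 0 tree0
| in_A_tree1 : in_A_level 0 tree1
| in_A_omega m (tau : nat -> tree) :
    (forall k, exists2 i, (i < m)%N & in_A_level i (tau k)) ->
    increasing tau ->
    in_A_level m (tree_omega tau)
| in_A_omegastar m (tau : nat -> tree) :
    (forall k, exists2 i, (i < m)%N & in_A_level i (tau k)) ->
    increasing tau ->
    in_A_level m (tree_omegastar tau)
| in_A_omega_plus m n (tau : nat -> 'I_n.+1 -> tree) :
    (1 <= n)%N ->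
    (forall k j, exists2 i, (i < m)%N & in_A_level i (tau k j)) ->
    (forall j, increasing (tau^~ j)) ->
    in_A_level m (tree_omega (fun k => tree_plus (tau k)))
| in_A_omegastar_plus m n (tau : nat -> 'I_n.+1 -> tree) :
    (1 <= n)%N ->
    (forall k j, exists2 i, (i < m)%N & in_A_level i (tau k j)) ->
    (forall j, increasing (tau^~ j)) ->
    in_A_level m (tree_omegastar (fun k => tree_plus (tau k))).

Definition in_A (sigma : tree) : Prop := exists m : nat, in_A_level m sigma.

Definition in_S (sigma : tree) : Prop :=
  in_A sigma \/
  exists (n : nat) (tau : 'I_n.+1 -> tree),
    [/\ (1 <= n)%N, forall j, in_A (tau j) & sigma = tree_plus tau].

Definition tree_bounded_finite_sums (sigma : tree) : Prop :=
  exists2 w : nat, (1 <= w)%N &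
    forall l, edge_label_occurs sigma l ->
      (exists k : nat, l = label_nat k) \/
      (exists2 k : nat, (k <= w)%N & l = label_iota k).

(* Only meant for countable scattered chains of finite Hausdorff rank. *)
Definition bounded_finite_sums d (S : orderType d) : Prop :=
  exists sigma : tree,
    [/\ in_S sigma, tree_bounded_finite_sums sigma &
        equimorphic S (encoded sigma)].

(* Main.v *)
(* A point of the chain encoded by a tree is determined by the word of edge   *)
(* labels on its branch, and in a tree of S with bounded finite sums these    *)
(* words have bounded length and only finitely many letters besides the       *)
(* natural numbers. So an n-tuple of points consists of a set of at most N    *)
(* naturals together with one of finitely many patterns recording where they  *)
(* sit. Colour each N-set by the function sending a pattern to the colour of  *)
(* the n-tuple it describes: Ramsey's theorem gives an infinite H on which    *)
(* the colour of an n-tuple depends on its pattern alone. Since the summands  *)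
(* increase, the chain still embeds into the points whose natural labels all  *)
(* lie in H.                                                                  *)

Require Import Defs.
From HB Require Import structures.
From mathcomp Require Import all_boot all_order ssrint rat.
From mathcomp Require Import boolp classical_sets functions cardinality.

Set Implicit Arguments.
Unset Strict Implicit.
Import Order.TTheory.

(** The point is to reduce an arbitrary colouring of n-tuples to Ramsey's theorem for finite sets of
    naturals. A point is recovered from its branch word ([code_inj]). Words have bounded length
    ([size_code_S]), so an n-tuple amounts to an N-set of naturals and a pattern from a finite type
    chosen before the colouring. [ramsey] gives [h] such that, for tuples with natural labels in the
    range of [h], the colour depends on the pattern alone. Since the summands increase, summand [k]
    can be moved into summand [h k], so the chain embeds into these points ([embeds_thin_S]). The
    number of patterns thus bounds the number of colours, and [few_colours_equimorphic] carries the
    bound to S. *)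

(** * Ramsey's theorem for N-element sets *)

Lemma infinite_pigeonhole (K : finType) (c : nat -> K) :
  exists e : nat -> nat, {homo e : x y / (x < y)%N} /\
    exists col, forall i, c (e i) = col.
Proof.
have [col colP] : exists col, forall m, exists i, (m <= i)%N /\ c i = col.
  apply: contrapT => /forallNP noinf.
  have /choice[b bP] col : exists b, forall i, (b <= i)%N -> c i <> col.
    have /existsNP[b bP] := noinf col.
    by exists b => i bi ci; apply: bP; exists i.
  by apply: (bP (c (\max_k b k)) (\max_k b k)) => //; apply: leq_bigmax.
have /choice[u uP] := colP.
pose fix e i := if i is i'.+1 then u (e i').+1 else u 0%N.
exists e; split.
  apply: homo_ltn => [y x z|i]; first exact: ltn_trans.
  by have [] := uP (e i).+1.
by exists col => -[|i]; [exact: (uP 0%N).2|exact: (uP (e i).+1).2].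
Qed.

(** Strictly increasing lists stand for N-sets, and the range of [h] is the homogeneous set. In the
    induction, repeated thinning makes the colour of a set depend only on its least element; the
    pigeonhole principle then fixes that colour. *)
Lemma ramsey (N : nat) (K : finType) (c : seq nat -> K) :
  exists h : nat -> nat, {homo h : x y / (x < y)%N} /\
    exists col, forall s, size s = N -> sorted ltn s -> c (map h s) = col.
Proof.
elim: N c => [|N IH] c.
  by exists id; split=> //; exists (c [::]) => s /size0nil->.
(* Keep the first term of [g] and thin the rest by the induction hypothesis, so that all sets with
   least element [g 0] get one colour. *)
have /choice[step stepP] (g : nat -> nat) : exists p : (nat -> nat) * K,
    {homo p.1 : x y / (x < y)%N} /\
    forall s, size s = N -> sorted ltn s ->
      c (g 0%N :: map (g \o succn \o p.1) s) = p.2.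
  have [h [h_homo [col colP]]] := IH (fun s => c (g 0%N :: map (g \o succn) s)).
  exists (h, col); split=> //= s sN s_sorted.
  by rewrite -(colP s) // -map_comp.
pose fix G i := if i is i'.+1 then G i' \o succn \o (step (G i')).1 else id.
have G_homo i : {homo G i : x y / (x < y)%N}.
  elim: i => [//|i IHi] x y xy /=; apply: IHi; rewrite ltnS.
  by have [+ _] := stepP (G i); apply.
have G_sub i j x : exists y, G (i + j)%N x = G i y.
  elim: j x => [|j IHj] x; first by exists x; rewrite addn0.
  by rewrite addnS; apply: IHj.
(* Diagonal sequence: all terms after [a i] lie in the range of [G i.+1], the part thinned for
   [a i]. *)
pose a i := G i 0%N.
have a_homo : {homo a : x y / (x < y)%N}.
  by apply: homo_ltn => [y x z|i]; [exact: ltn_trans|apply: G_homo].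
have aP i s : size s = N -> sorted ltn s -> all (ltn i) s ->
    c (a i :: map a s) = (step (G i)).2.
  move=> sN s_sorted s_gt.
  have /choice[y yP] j : exists y, (i < j)%N -> a j = G i.+1 y.
    case: (ltnP i j) => [ij|]; last by exists 0%N.
    by have [y] := G_sub i.+1 (j - i.+1)%N 0%N; rewrite subnKC //; exists y.
  have [_ /(_ (map y s)) <-] := stepP (G i).
  - congr (c (_ :: _)); rewrite -[RHS]map_comp.
    by apply/eq_in_map => j js /=; apply: yP; apply: (allP s_gt).
  - by rewrite size_map.
  apply: homo_sorted_in s_gt s_sorted => j k ij ik jk.
  have := a_homo _ _ jk; rewrite (yP j) // (yP k) //.
  by rewrite (leqW_mono (leq_mono (G_homo i.+1))).
have [e [e_homo [col colP]]] := infinite_pigeonhole (fun i => (step (G i)).2).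
exists (a \o e); split=> [x y xy|]; first by apply/a_homo/e_homo.
exists col => -[//|x s] [sN] /= xs.
rewrite map_comp aP ?size_map //.
  by apply: homo_sorted (path_sorted xs).
rewrite all_map; apply: sub_all (order_path_min ltn_trans xs) => y.
exact: e_homo.
Qed.

(** A tuple may use fewer than N naturals, while Ramsey's theorem speaks of sets of size exactly
    N. *)
Lemma sorted_pad (N : nat) (s : seq nat) : (size s <= N)%N ->
  exists r, [/\ size r = N, sorted ltn r & {subset s <= r}].
Proof.
move=> sN; pose m := (\max_(i <- s) i).+1.
pose r := undup s ++ iota m (N - size (undup s)).
exists (sort leq r); split.
- rewrite size_sort size_cat size_iota subnKC //.
  exact: leq_trans (size_undup s) sN.
- rewrite ltn_sorted_uniq_leq sort_uniq (sort_sorted leq_total) andbT.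
  rewrite cat_uniq undup_uniq iota_uniq andbT /=; apply/hasPn => x.
  rewrite mem_iota mem_undup => /andP[mx _]; apply/negP => xs.
  by move: mx; rewrite leqNgt ltnS ((@leq_bigmax_seq _ s xpredT id)).
- by move=> x xs; rewrite mem_sort mem_cat mem_undup xs.
Qed.

(** * Order embeddings and lexicographic sums *)

Section Embeddings.
Variables (dA dB dC : Order.disp_t).
Variables (A : orderType dA) (B : orderType dB) (C : orderType dC).

Lemma homo_order_embedding (f : A -> B) :
  {homo f : x y / (x < y)%O} -> order_embedding f.
Proof. by move=> f_homo; apply/leW_mono/le_mono. Qed.

Lemma order_embedding_inj (f : A -> B) : order_embedding f -> injective f.
Proof.
move=> fP x y fxy; case: (ltgtP x y) => // xy.
- by have := fP x y; rewrite fxy ltxx xy.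
- by have := fP y x; rewrite fxy ltxx xy.
Qed.

Lemma order_embedding_comp (g : B -> C) (f : A -> B) :
  order_embedding g -> order_embedding f -> order_embedding (g \o f).
Proof. by move=> gP fP x y /=; rewrite gP fP. Qed.

End Embeddings.

Lemma sum_order_embedding dI dJ dA dB (I : orderType dI) (J : orderType dJ)
    (A : I -> orderType dA) (B : J -> orderType dB)
    (h : I -> J) (f : forall i, A i -> B (h i)) :
  order_embedding h -> (forall i, order_embedding (f i)) ->
  order_embedding (fun x : {i : I & A i} =>
    Tagged (fun j => B j) (f (tag x) (tagged x)) : {j : J & B j}).
Proof.
move=> hP fP; apply: homo_order_embedding => -[i a] [j b].
rewrite !ltEsig /= => /andP[].
rewrite le_eqVlt => /predU1P[ij|ij].
  by subst j; rewrite !lexx /= !tagged_asE fP.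
by move=> _; rewrite ltW ?hP //= leNgt hP ij.
Qed.

(** * Branch words *)

(* [inl] and [inr] stand for [label_nat] and [label_iota]. *)
Fixpoint code (sigma : tree) : encoded sigma -> seq (nat + nat) :=
  match sigma return encoded sigma -> seq (nat + nat) with
  | tree0 | tree1 => fun _ => [::]
  | tree_plus n tau => fun x : {k : 'I_n.+1 & encoded (tau k)} =>
      inr (nat_of_ord (tag x)) :: code (tagged x)
  | tree_omega tau => fun x : {k : nat & encoded (tau k)} =>
      inl (tag x) :: code (tagged x)
  | tree_omegastar tau => fun x : {k : nat^d & encoded (tau k)} =>
      inl (tag x) :: code (tagged x)
  end.

Lemma code_inj (sigma : tree) : injective (@code sigma).
Proof.
elim: sigma => [||n tau IH|tau IH|tau IH].
- by case.
- by move=> x y _; rewrite (ord1 x) (ord1 y).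
- by move=> [i x] [j y] /= [/val_inj ij]; subst j => /IH ->.
- by move=> [i x] [j y] /= [ij]; subst j => /IH ->.
- by move=> [i x] [j y] /= [ij]; subst j => /IH ->.
Qed.

Lemma code_label_occurs (sigma : tree) (x : encoded sigma) (i : nat) :
  inr i \in code x -> edge_label_occurs sigma (label_iota i).
Proof.
elim: sigma x => [||n tau IH|tau IH|tau IH] //= -[k x] /=; rewrite inE.
- case/predU1P=> [[->]|/IH ix]; exists k; [by left|by right].
- by case/predU1P=> [//|/IH ix]; exists k; right.
- by case/predU1P=> [//|/IH ix]; exists k; right.
Qed.

(** Each level adds at most two letters: a natural and possibly the index of a finite sum. *)
Lemma size_code_A (m : nat) (sigma : tree) (x : encoded sigma) :
  in_A_level m sigma -> (size (code x) <= m.*2)%N.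
Proof.
elim/ltn_ind: m sigma x => m IH sigma x sigmaA.
have IHS i tau (y : encoded tau) : (i < m)%N -> in_A_level i tau ->
    ((size (code y)).+2 <= m.*2)%N.
  move=> im tauA; apply: (@leq_trans i.*2.+2); first by rewrite !ltnS IH.
  by rewrite -doubleS leq_double.
case: sigmaA x IH IHS => {m sigma}
  [//|//|m tau|m tau|m n tau _|m n tau _] tauA _ [k x] _ IHS /=.
- by have [i im /(IHS _ _ x im)] := tauA k; apply: ltnW.
- by have [i im /(IHS _ _ x im)] := tauA k; apply: ltnW.
- by case: x => j x; have [i im /(IHS _ _ x im)] := tauA k j.
- by case: x => j x; have [i im /(IHS _ _ x im)] := tauA k j.
Qed.

Lemma size_code_S (sigma : tree) :
  in_S sigma -> exists D, forall x : encoded sigma, (size (code x) <= D)%N.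
Proof.
case=> [[m sigmaA]|[n [tau [_ tauA ->]]]].
  by exists m.*2 => x; apply: size_code_A.
have /choice[m mP] := tauA.
exists (\max_j m j).*2.+1 => -[j x] /=; rewrite ltnS.
by apply: leq_trans (size_code_A x (mP j)) _; rewrite leq_double leq_bigmax.
Qed.

(** * Self-embeddings onto branches with labels in the range of [h] *)

Section Thinning.
Variable h : nat -> nat.
Hypothesis h_homo : {homo h : x y / (x < y)%N}.

(* The image uses only branches whose natural labels lie in the range of h. *)
Definition embeds_thin (sigma sigma' : tree) : Prop :=
  exists f : encoded sigma -> encoded sigma', order_embedding f /\
    forall x a, inl a \in code (f x) -> exists b, a = h b.

Lemma embeds_thin_trans (sigma tau rho : tree) :
  embeds (encoded sigma) (encoded tau) -> embeds_thin tau rho ->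
  embeds_thin sigma rho.
Proof.
move=> [g gP] [f [fP f_thin]]; exists (f \o g).
by split=> [|x a]; [exact: order_embedding_comp|exact: f_thin].
Qed.

Lemma embeds_thin_plus n (tau tau' : 'I_n.+1 -> tree) :
  (forall j, embeds_thin (tau j) (tau' j)) ->
  embeds_thin (tree_plus tau) (tree_plus tau').
Proof.
move=> thin; pose f j := sval (cid (thin j)).
have fP j : order_embedding (f j) by have [] := svalP (cid (thin j)).
exists (fun x : {k : 'I_n.+1 & encoded (tau k)} =>
  Tagged (fun k => encoded (tau' k)) (f (tag x) (tagged x))).
split=> [|[j x] a /=]; first exact: (@sum_order_embedding _ _ _ _ _ _ _ _ id).
rewrite inE /= => ax; have [_ f_thin] := svalP (cid (thin j)).
exact: f_thin ax.
Qed.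

Lemma embeds_thin_omega (tau tau' : nat -> tree) :
  (forall k, embeds_thin (tau k) (tau' (h k))) ->
  embeds_thin (tree_omega tau) (tree_omega tau').
Proof.
move=> thin; pose f k := sval (cid (thin k)).
have fP k : order_embedding (f k) by have [] := svalP (cid (thin k)).
exists (fun x : {k : nat & encoded (tau k)} =>
  Tagged (fun k => encoded (tau' k)) (f (tag x) (tagged x))).
split=> [|[k x] a /=].
  apply: (@sum_order_embedding _ _ _ _ _ _ _ _ h) => //.
  exact: homo_order_embedding.
rewrite inE => /predU1P[[->]|ax]; first by exists k.
by have [_ f_thin] := svalP (cid (thin k)); apply: f_thin ax.
Qed.

Lemma embeds_thin_omegastar (tau tau' : nat -> tree) :
  (forall k, embeds_thin (tau k) (tau' (h k))) ->
  embeds_thin (tree_omegastar tau) (tree_omegastar tau').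
Proof.
move=> thin; pose f k := sval (cid (thin k)).
have fP k : order_embedding (f k) by have [] := svalP (cid (thin k)).
exists (fun x : {k : nat^d & encoded (tau k)} =>
  Tagged (fun k : nat^d => encoded (tau' k)) (f (tag x) (tagged x))).
split=> [|[k x] a /=].
  apply: (@sum_order_embedding _ _ _ _ nat^d nat^d _ _ h) => //.
  by apply: homo_order_embedding => x y; apply: h_homo.
rewrite inE => /predU1P[[->]|ax]; first by exists k.
by have [_ f_thin] := svalP (cid (thin k)); apply: f_thin ax.
Qed.

Lemma increasing_embeds (tau : nat -> tree) (i j : nat) :
  increasing tau -> (i <= j)%N -> embeds (encoded (tau i)) (encoded (tau j)).
Proof.
move=> tau_inc; elim: j => [|j IH].
  by rewrite leqn0 => /eqP->; exists id.
rewrite leq_eqVlt => /predU1P[->|]; first by exists id.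
rewrite ltnS => /IH[f fP]; have [g gP] := tau_inc j.
by exists (g \o f); apply: order_embedding_comp.
Qed.

Lemma leq_increasing_fun (k : nat) : (k <= h k)%N.
Proof. by elim: k => // k IH; apply: leq_ltn_trans IH (h_homo _). Qed.

(** Since [k <= h k], summand [k] embeds into summand [h k], which embeds thinly into itself by
    induction. For summands that are finite sums this is done separately for each index [j]. *)
Lemma embeds_thin_A (m : nat) (sigma : tree) :
  in_A_level m sigma -> embeds_thin sigma sigma.
Proof.
elim/ltn_ind: m sigma => m IH sigma sigmaA.
have IHS tau : (forall k, exists2 i, (i < m)%N & in_A_level i (tau k)) ->
    increasing tau -> forall k, embeds_thin (tau k) (tau (h k)).
  move=> tauA tau_inc k; have [i im tauAi] := tauA (h k).
  apply: embeds_thin_trans (IH _ im _ tauAi).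
  exact: increasing_embeds (leq_increasing_fun k).
case: sigmaA IHS => {m sigma IH}
  [||m tau tauA tau_inc|m tau tauA tau_inc
  |m n tau _ tauA tau_inc|m n tau _ tauA tau_inc] IHS.
- by exists id.
- by exists id.
- by apply: embeds_thin_omega; apply: IHS.
- by apply: embeds_thin_omegastar; apply: IHS.
- apply: embeds_thin_omega => k; apply: embeds_thin_plus => j.
  exact: (IHS (tau^~ j)).
- apply: embeds_thin_omegastar => k; apply: embeds_thin_plus => j.
  exact: (IHS (tau^~ j)).
Qed.

Lemma embeds_thin_S (sigma : tree) : in_S sigma -> embeds_thin sigma sigma.
Proof.
case=> [[m /embeds_thin_A//]|[n [tau [_ tauA ->]]]].
by apply: embeds_thin_plus => j; have [m /embeds_thin_A] := tauA j.
Qed.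

End Thinning.

(** * Colour bounds and equimorphism *)

Definition few_colours (n t : nat) d (C : orderType d) : Prop :=
  forall (k : nat) (chi : Emb n C -> 'I_k),
  exists2 g : C -> C, order_embedding g &
  exists2 L : seq 'I_k, (size L <= t)%N &
  forall e : Emb n C, (forall j, range g (sval e j)) -> chi e \in L.

Lemma Emb_inj (n : nat) d (C : orderType d) (e e' : Emb n C) :
  (forall j, sval e j = sval e' j) -> e = e'.
Proof.
case: e e' => [f fP] [f' f'P] /= /funext ff'; subst f'.
by congr exist; apply: Prop_irrelevance.
Qed.

(** Colour tuples of B by their images in A under [h]; the good copy in B then returns to A as the
    range of [h \o g \o f]. *)
Lemma few_colours_equimorphic (n t : nat) dA dB
    (A : orderType dA) (B : orderType dB) :
  equimorphic A B -> few_colours n t B -> few_colours n t A.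
Proof.
move=> [[f fP] [h hP]] BP k chi.
pose push (e : Emb n B) : Emb n A :=
  exist _ (h \o sval e) (order_embedding_comp hP (svalP e)).
have [g gP [L Lt LP]] := BP k (chi \o push).
exists (h \o g \o f); first by do 2!apply: order_embedding_comp.
exists L => // e eU.
have /choice[e' e'P] j : exists b, range g b /\ sval e j = h b.
  by have [x _ <-] := eU j; exists (g (f x)); split=> //; exists (f x).
have e'_emb : order_embedding e'.
  by move=> i j; rewrite -(svalP e i j) !(e'P _).2 hP.
have -> : e = push (exist _ e' e'_emb).
  by apply: Emb_inj => j; rewrite (e'P j).2.
by apply: LP => j; apply: (e'P j).1.
Qed.

(** The successor keeps the bound positive even when [t] is 0. *)
Lemma few_colours_ramsey_bound (n t : nat) d (C : orderType d) :
  few_colours n t C -> ramsey_bound n C t.+1.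
Proof.
move=> CP; split=> // k _ chi; have [g gP [L Lt LP]] := CP k chi.
exists (range g); split.
  exists g; split=> //; split=> [x _|x y _ _|]; [by exists x| |by []].
  exact: order_embedding_inj gP _ _.
rewrite -card_ge_some.
apply: card_le_trans (card_image_le (onth L) `I_t.+1).
apply: subset_card_le => _ [_ [e eU <-] <-].
have eL : chi e \in L by apply: LP => j; apply: eU; exists j.
exists (index (chi e) L); last first.
  by rewrite onthE (nth_map (chi e)) ?index_mem // nth_index.
by rewrite /= ltnS (leq_trans _ Lt) // ltnW ?index_mem.
Qed.

(** * Patterns and the induced colouring of N-sets *)

Section Colouring.
Variables (n : nat) (sigma : tree) (D w : nat).
Hypothesis size_code : forall x : encoded sigma, (size (code x) <= D)%N.
Hypothesis code_iota :
  forall (x : encoded sigma) i, inr i \in code x -> (i <= w)%N.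

(** [n] words of at most [D] letters involve at most [n * D] naturals. *)
Let N := (n * D)%N.
Let letter : finType := ('I_N + 'I_w.+1)%type.

(* In a pattern, [inl r] stands for the r-th element of the N-set F. *)
Let decode (F : seq nat) (l : letter) : nat + nat :=
  match l with inl r => inl (nth 0%N F r) | inr i => inr (nat_of_ord i) end.

Let pattern : finType := {ffun 'I_n -> D.-bseq letter}.

Let realizes (F : seq nat) (P : pattern) (e : Emb n (encoded sigma)) : Prop :=
  forall j, code (sval e j) = map (decode F) (P j).

Lemma realizes_unique F P e e' : realizes F P e -> realizes F P e' -> e = e'.
Proof.
move=> eP e'P; apply: Emb_inj => j.
by apply: code_inj; rewrite eP e'P.
Qed.

Lemma pattern_exists (h : nat -> nat) (e : Emb n (encoded sigma)) :
  (forall j a, inl a \in code (sval e j) -> exists b, a = h b) ->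
  exists s, [/\ size s = N, sorted ltn s &
    exists P, realizes (map h s) P e].
Proof.
move=> e_thin.
(* [u] inverts [h] on the natural labels that occur; elsewhere its value is arbitrary. *)
have /choice[u uP] (a : nat) : exists b,
    (exists j, inl a \in code (sval e j)) -> a = h b.
  case: (pselect (exists j, inl a \in code (sval e j))) => [[j aj]|];
    last by exists 0%N.
  by have [b ->] := e_thin j a aj; exists b.
pose val_label (l : nat + nat) := if l is inl a then a else 0%N.
pose indices j := [seq u (val_label l) | l <- code (sval e j)].
pose s0 := flatten [seq indices j | j <- enum 'I_n].
have s0N : (size s0 <= N)%N.
  rewrite size_flatten /shape -map_comp sumnE big_map big_enum /=.
  rewrite /N -[X in (X * _)%N]card_ord -sum_nat_const.
  by apply: leq_sum => j _; rewrite size_map.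
have [s [sN s_sorted s0s]] := sorted_pad s0N.
exists s; split=> //.
have wordP j : exists p : D.-bseq letter,
    code (sval e j) = map (decode (map h s)) p.
  have lP l : l \in code (sval e j) -> exists l', decode (map h s) l' = l.
    case: l => [a|i] lj.
      have us : u a \in s.
        apply: s0s; apply/flattenP; exists (indices j).
          by apply/mapP; exists j; rewrite ?mem_enum.
        by apply/mapP; exists (inl a).
      have ltN : (index (u a) s < N)%N by rewrite -sN index_mem.
      exists (inl (Ordinal ltN)) => /=.
      by rewrite (nth_map 0%N) ?index_mem // nth_index // -uP //; exists j.
    by exists (inr (Ordinal (code_iota lj : (i < w.+1)%N))).
  have [p pE] : exists p, map (decode (map h s)) p = code (sval e j).
    elim: (code _) lP => [|l c IH] lP; first by exists [::].
    have [l' l'E] := lP l (mem_head l c).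
    have [|p pE] := IH; first by move=> x xc; apply: lP; rewrite inE xc orbT.
    by exists (l' :: p); rewrite /= l'E pE.
  have pD : (size p <= D)%N by rewrite -(size_map (decode (map h s))) pE.
  by exists (Bseq pD).
have [P PP] := choice wordP.
by exists (finfun P) => j; rewrite ffunE.
Qed.

Lemma few_colours_encoded :
  in_S sigma -> few_colours n #|pattern| (encoded sigma).
Proof.
move=> sigmaS k chi.
(* The colour of [F] is a whole table from patterns to colours, well defined by [realizes_unique];
   unrealized patterns get [None]. *)
have /choice[c cP] (F : seq nat) : exists c : {ffun pattern -> option 'I_k},
    forall P e, realizes F P e -> c P = Some (chi e).
  have /choice[c cP] (P : pattern) : exists o : option 'I_k,
      forall e, realizes F P e -> o = Some (chi e).
    case: (pselect (exists e, realizes F P e)) => [[e eP]|noe].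
      by exists (Some (chi e)) => e' /(realizes_unique eP) <-.
    by exists None => e eP; case: noe; exists e.
  by exists (finfun c) => P e eP; rewrite ffunE (cP P e eP).
have [h [h_homo [col colP]]] := ramsey N c.
have [g [gP g_thin]] := embeds_thin_S h_homo sigmaS.
(* The homogeneous table [col] lists every colour that can survive, at most one per pattern. *)
exists g => //; exists (pmap col (enum pattern)).
  by rewrite size_pmap (leq_trans (count_size _ _)) // cardE.
move=> e eg; have [|s [sN s_sorted [P PP]]] := @pattern_exists h e.
  by move=> j a; have [x _ <-] := eg j; apply: g_thin.
rewrite mem_pmap; apply/mapP; exists P; rewrite ?mem_enum //.
by rewrite -(colP s) // (cP _ _ _ PP).
Qed.

End Colouring.

Theorem theorem5p9 (d : Order.disp_t) (S : orderType d)
    (S_countable : countable [set: S]%classic)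
    (S_scattered : scattered S)
    (S_finite_rank : finite_hausdorff_rank S)
    (S_bounded : bounded_finite_sums S) :
  finite_big_ramsey_spectrum S.
Proof.
have [sigma [sigmaS [w _ wP] S_sigma]] := S_bounded.
have [D size_code] := size_code_S sigmaS.
have code_iota (x : encoded sigma) i : inr i \in code x -> (i <= w)%N.
  by move/code_label_occurs/wP => [[]|[k kw [->]]].
move=> n _; rewrite /big_ramsey_degree; case: pselect => // no_bound.
case: no_bound; eexists; apply/asboolP; apply: few_colours_ramsey_bound.
apply: few_colours_equimorphic S_sigma _.
exact: (few_colours_encoded size_code code_iota sigmaS).
Qed.
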